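(* For every ordinal $\alpha$, there is a non-empty, sober Noetherian space $X_\alpha$ whose stature satisfies $||X_\alpha|| \geq \alpha$, and such that all the chains in $\mathcal{H}_0 X_\alpha$ are countable. In particular, when $\alpha \geq \aleph_1$, $\ell(\mathcal{H}_0 X_\alpha) < ||X_\alpha|| + 1$.
   Context: A topological space is Noetherian if every open subset is compact (every open cover has a finite subcover; no separation is required). A closed subset $C$ of $X$ is irreducible if it is non-empty and, whenever $C \subseteq F_1 \cup F_2$ with $F_1, F_2$ closed in $X$, we have $C \subseteq F_1$ or $C \subseteq F_2$. A space is sober if every irreducible closed subset is the closure of a unique point. For a well-founded poset $P$ and $x \in P$, $\mathrm{rk}_P(x) = \sup_{x' < x} (\mathrm{rk}_P(x')+1)$ and the ordinal rank of $P$ is $|P| = \sup_{x \in P} (\mathrm{rk}_P(x)+1)$, where $\sup\emptyset = 0$. $\mathcal{H}_0 X$ is the poset of all closed subsets of $X$ (including $\emptyset$), ordered by inclusion; it is well-founded when $X$ is Noetherian. The stature of a Noetherian space $X$ is $||X|| = |\mathcal{H}_0 X| - 1$, equivalently $||X|| = \mathrm{rk}_{\mathcal{H}_0 X}(X)$. A chain in a poset $P$ is a non-empty totally ordered subset. When $P$ is well-founded, a chain is isomorphic to a unique non-zero ordinal, called its length; the chain length $\ell(P)$ is the supremum of the lengths of the chains of $P$. Here $\aleph_1$ denotes the first uncountable ordinal. *)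

(* Defs.v *)
From HB Require Import structures.
From mathcomp Require Import all_boot all_order finmap.
From mathcomp Require Import all_classical topology.

Set Implicit Arguments.
Unset Strict Implicit.
Unset Printing Implicit Defensive.

Import Order.TTheory.

Local Open Scope classical_set_scope.

(* Ordinals are well-founded trees: [osupS f] denotes sup_i (f i + 1), and
   every ordinal arises this way, from a family enumerating the ordinals
   strictly below it. Two trees can denote the same ordinal, so equality of
   ordinals is [oeq], not Leibniz equality. *)
Inductive Ord : Type := osupS (I : Type) (f : I -> Ord).

Fixpoint ole (a b : Ord) {struct a} : Prop :=
  let: osupS J f := a in
  forall i : J, let: osupS K g := b in exists k : K, ole (f i) (g k).

Definition olt (a b : Ord) : Prop :=
  let: osupS K g := b in exists k : K, ole a (g k).

Definition oeq (a b : Ord) : Prop := ole a b /\ ole b a.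

Definition osucc (a : Ord) : Ord := osupS (fun _ : unit => a).

Definition oindex (a : Ord) : Type := let: osupS J _ := a in J.

Definition oelt (a : Ord) : oindex a -> Ord :=
  let: osupS J f := a in f.

(* sup_i (f i): as sets of smaller ordinals, the union of the [f i]. *)
Definition osup (I : Type) (f : I -> Ord) : Ord :=
  osupS (fun p : {i : I & oindex (f i)} => oelt (projT2 p)).

Lemma oleE a I (f : I -> Ord) : ole (osupS f) a <-> forall i, olt (f i) a.
Proof. by case: a. Qed.

Lemma ole_refl a : ole a a.
Proof. by elim: a => I f IH i; exists i; exact: IH. Qed.

Lemma ole_trans a b c : ole a b -> ole b c -> ole a c.
Proof.
elim: a b c => I f IH [J g] [K h] ab bc i.
by have [j ij] := ab i; have [k jk] := bc j; exists k; exact: IH jk.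
Qed.

Lemma ole_lt_trans a b c : ole a b -> olt b c -> olt a c.
Proof. by case: c => K h ab [k bk]; exists k; exact: ole_trans bk. Qed.

Lemma olt_le_trans a b c : olt a b -> ole b c -> olt a c.
Proof.
case: b => J g [j aj] /oleE /(_ j); exact: ole_lt_trans.
Qed.

Lemma oltW a b : olt a b -> ole a b.
Proof.
elim: a b => I f IH b; case: b => J g [j ab].
apply/oleE => i; exists j; apply: IH; move: ab => /oleE; exact.
Qed.

Lemma olt_trans a b c : olt a b -> olt b c -> olt a c.
Proof. by move=> /oltW; exact: ole_lt_trans. Qed.

Lemma olt_osupS I (f : I -> Ord) i : olt (f i) (osupS f).
Proof. by exists i; exact: ole_refl. Qed.

Lemma olt_wf : well_founded olt.
Proof.
suff H a b : ole b a -> Acc olt b by move=> a; exact: H (ole_refl a).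
elim: a b => I f IH b ba; constructor => c cb.
by have [i /IH] := olt_le_trans cb ba.
Qed.

Lemma olt_irr a : ~ olt a a.
Proof. by elim/(well_founded_ind olt_wf): a => a IH aa; exact: (IH a). Qed.

Lemma ole_total a b : ole a b \/ olt b a.
Proof.
elim: a b => I f IH b; have [h|/existsNP[i fib]] := pselect (forall i, olt (f i) b).
  by left; apply/oleE.
right; exists i; case: b fib => J g fib; apply/oleE => j.
by have [fg|//] := IH i (g j); case: fib; exists j.
Qed.

Lemma oleP a b : (forall c, olt c a -> olt c b) -> ole a b.
Proof. by case: a => I f h; apply/oleE => i; apply: h; exact: olt_osupS. Qed.

Lemma osup_ub I (f : I -> Ord) i : ole (f i) (osup f).
Proof.
case E : (f i) => [J g]; apply/oleE => j.
have [k <-] : exists k : oindex (f i), oelt k = g j by rewrite E; exists j.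
by exists (existT _ i k); exact: ole_refl.
Qed.

Lemma osup_le I (f : I -> Ord) a : (forall i, ole (f i) a) -> ole (osup f) a.
Proof.
move=> h; apply/oleE => -[i k] /=.
by move: k (h i); case: (f i) => J g /= k /oleE.
Qed.

(* With R the strict order: [rk x] = sup_{y < x} (rk y + 1), see [rkE], and
   [orank] = sup_x (rk x + 1). *)
Section rank.
Variables (T : Type) (R : T -> T -> Prop) (wfR : well_founded R).

Definition rk : T -> Ord :=
  Fix wfR (fun=> Ord)
    (fun x rec => osupS (fun y : {y | R y x} => rec (sval y) (proj2_sig y))).

Definition orank : Ord := osupS rk.

Lemma rkE x : rk x = osupS (fun y : {y | R y x} => rk (sval y)).
Proof.
rewrite /rk Fix_eq // => {}x f g fg; congr osupS; apply/funext => y; exact: fg.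
Qed.

Lemma rk_lt x y : R x y -> olt (rk x) (rk y).
Proof. by move=> xy; rewrite (rkE y); exists (exist _ x xy); exact: ole_refl. Qed.

Lemma olt_rk a x : olt a (rk x) -> exists2 y, R y x & ole a (rk y).
Proof. by rewrite rkE => -[[y yx] /= h]; exists y. Qed.

Lemma ole_rk a x : ole a (rk x) -> exists y, oeq a (rk y).
Proof.
elim/(well_founded_ind wfR): x => x IH ax.
have [xa|] := ole_total (rk x) a; first by exists x.
by move=> /olt_rk[y yx]; exact: IH.
Qed.

End rank.

(* Sup of all (rank + 1) of well-founded relations on nat: the sup of the
   successors of the countable ordinals. *)
Definition aleph1 : Ord :=
  osupS (fun R : {R : nat -> nat -> Prop | well_founded R} => orank (proj2_sig R)).

Definition ocountable (a : Ord) : Prop :=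
  exists f : nat -> Ord, forall b, olt b a -> exists n, oeq b (f n).

Lemma aleph1_first_uncountable :
  ~ ocountable aleph1 /\ forall a, olt a aleph1 -> ocountable a.
Proof.
split=> [[f fP]|a [[R wfR] /= aR]]; last first.
  by exists (rk wfR) => b ba; have [n bn] := olt_le_trans ba aR; exact: ole_rk bn.
pose R m n := olt (f m) (f n).
have wfR : well_founded R.
  move=> n; have := olt_wf (f n); move Ea: (f n) => a h.
  elim: h n Ea => {}a _ IH n fna; constructor => m mn.
  by apply: (IH (f m)) => //; rewrite -fna.
have lef n : ole (f n) aleph1 -> ole (f n) (rk wfR n).
  elim/(well_founded_ind wfR): n => n IH nw; apply: oleP => c cn.
  have [m [cm mc]] := fP _ (olt_le_trans cn nw).
  have mn : R m n by exact: ole_lt_trans mc cn.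
  apply: ole_lt_trans cm (ole_lt_trans (IH _ mn _) (rk_lt wfR mn)).
  by apply: ole_trans nw; exact: oltW.
suff h : ole aleph1 (orank wfR).
  by apply: (@olt_irr aleph1); exists (exist _ R wfR).
apply: oleP => c ca; have [n [cn nc]] := fP _ ca; exists n.
by apply: (ole_trans cn); apply: lef; apply: ole_trans nc (oltW ca).
Qed.

Section chains.
Variables (d : Order.disp_t) (P : porderType d).
Implicit Types C : set P.

Definition wf_poset : Prop := well_founded (fun x y : P => (x < y)%O).

Definition chain C : Prop :=
  C !=set0 /\ total_on C (fun x y => (x <= y)%O).

(* [C] is order-isomorphic to the ordinal [a], seen as the set of the
   ordinals strictly below it. *)
Definition order_type C (a : Ord) : Prop :=
  exists f : P -> Ord,
    [/\ forall x, C x -> olt (f x) a,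
        forall b, olt b a -> exists2 x, C x & oeq b (f x) &
        forall x y, C x -> C y -> ((x <= y)%O <-> ole (f x) (f y))].

Hypothesis wfP : wf_poset.

Lemma chain_order_type C : chain C -> exists a, order_type C a.
Proof.
move=> [_ Ctot]; pose R (x y : {x | C x}) := (sval x < sval y)%O.
have wfR : well_founded R.
  move=> x; have := wfP (sval x); move xa: (sval x) => a h.
  elim: h x xa => {}a _ IH x xa; constructor => y yx.
  by apply: (IH (sval y)) => //; rewrite -xa.
pose f x := if pselect (C x) is left Cx then rk wfR (exist _ x Cx) else osupS (of_void Ord).
have fE x (Cx : C x) : f x = rk wfR (exist _ x Cx).
  rewrite /f; case: pselect => // Cx'.
  by congr (rk _ (exist _ _ _)); exact: Prop_irrelevance.
exists (orank wfR), f; split=> [x Cx|b [x bx]|x y Cx Cy].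
- by rewrite fE; exact: olt_osupS.
- have [[y Cy] yb] := ole_rk bx.
  by exists y => //; rewrite fE.
- rewrite !fE; split=> [|h].
    rewrite le_eqVlt => /predU1P[xy|xy].
      by subst y; rewrite (Prop_irrelevance Cx Cy); exact: ole_refl.
    by apply/oltW/rk_lt.
  have [//|] := Ctot x y Cx Cy; rewrite le_eqVlt => /predU1P[->//|yx].
  case: (@olt_irr (rk wfR (exist _ x Cx))); apply: ole_lt_trans h _.
  exact: rk_lt.
Qed.

Lemma order_type_unique C a b : order_type C a -> order_type C b -> oeq a b.
Proof.
suff H c e : order_type C c -> order_type C e -> ole c e by split; exact: H.
move=> {a b} [f [fc cf fle]] [g [ge eg gle]].
have fg x : C x -> ole (f x) (g x).
  elim/(well_founded_ind wfP): x => x IH Cx; apply: oleP => b bx.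
  have [y Cy [by_ yb]] := cf _ (olt_trans bx (fc _ Cx)).
  have fyx := ole_lt_trans yb bx.
  have yx : (y < x)%O.
    rewrite lt_leAnge; apply/andP; split; first exact/(fle _ _ Cy Cx)/oltW.
    by apply/negP => /(fle _ _ Cx Cy) xy; exact: olt_irr (ole_lt_trans xy fyx).
  apply: ole_lt_trans by_ (ole_lt_trans (IH _ yx Cy) _).
  have [/(gle _ _ Cx Cy) xy|//] := ole_total (g x) (g y).
  by move: yx; rewrite lt_leAnge xy andbF.
apply: oleP => b bc; have [x Cx [bx _]] := cf _ bc.
exact: ole_lt_trans bx (ole_lt_trans (fg _ Cx) (ge _ Cx)).
Qed.

(* The ordinal isomorphic to [C], unique by [order_type_unique]. *)
Definition length_of_chain (C : {C : set P | chain C}) : Ord :=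
  sval (cid (chain_order_type (proj2_sig C))).

Definition chain_length : Ord := osup length_of_chain.

End chains.

(* Finite subcovers: the filter-based [compact] is only known to be equivalent
   on pointed spaces ([compact_cover]). *)
Definition noetherian (X : topologicalType) : Prop :=
  forall U : set X, open U -> cover_compact U.

Definition irreducible_closed (X : topologicalType) (C : set X) : Prop :=
  [/\ closed C, C !=set0 &
      forall F1 F2 : set X, closed F1 -> closed F2 ->
        C `<=` F1 `|` F2 -> C `<=` F1 \/ C `<=` F2].

Definition sober (X : topologicalType) : Prop :=
  forall C : set X, irreducible_closed C -> exists! x, C = closure [set x].

Definition H0 (X : topologicalType) : Type := {C : set X | `[< closed C >]}.

HB.instance Definition _ (X : topologicalType) := SubChoice.on (H0 X).
HB.instance Definition _ (X : topologicalType) :=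
  [SubChoice_isSubPOrder of H0 X by <: with set_display].

Section hyperspace.
Variable X : topologicalType.

Lemma H0_leE (C D : H0 X) : (C <= D)%O <-> val C `<=` val D.
Proof. by rewrite -(Order.le_val C D) subsetEset. Qed.

Definition H0_top : H0 X := exist _ [set: X] (introT (asboolP _) closedT).

Lemma noetherian_wf : noetherian X -> wf_poset (H0 X).
Proof.
move=> NX C; apply: contrapT => nC.
pose bad := {C : H0 X | ~ Acc (fun x y : H0 X => (x < y)%O) C}.
have step (x : bad) : exists y : bad, (sval y < sval x)%O.
  case: x => D nD /=; apply: contrapT => h; apply: nD; constructor => E ED.
  by apply: contrapT => nE; apply: h; exists (exist _ E nE).
pose s n := sval (iter n (fun x => sval (cid (step x))) (exist _ C nC)).
have slt n : (s n.+1 < s n)%O by rewrite /s iterS; case: cid.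
have sle m n : (m <= n)%N -> (s n <= s m)%O.
  move=> /subnK <-; elim: (n - m)%N => // k IH.
  by rewrite addSn; apply: le_trans IH; exact: ltW (slt _).
pose U := \bigcup_(n in [set: nat]) ~` (val (s n)).
have oU n : open (~` val (s n)) by apply/closed_openC/asboolP; exact: valP (s n).
have [|||D _ UD] := NX U _ nat setT (fun n => ~` val (s n)).
- by apply: bigcup_open => n _; exact: oU.
- by move=> n _; exact: oU.
- exact: subset_refl.
pose N := (\max_(n <- D) n)%N.
suff : (s N <= s N.+1)%O by rewrite (lt_geF (slt N)).
apply/H0_leE => x sNx; apply: contrapT => nx.
have [n /= Dn] := UD x (ex_intro2 _ _ N.+1 I nx); apply.
by have /H0_leE := sle n N (@leq_bigmax_seq _ _ predT id n Dn isT); exact.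
Qed.

Hypothesis NX : noetherian X.

(* |H0 X| - 1, by [orank_H0]. *)
Definition stature : Ord := rk (noetherian_wf NX) H0_top.

Lemma orank_H0 : oeq (orank (noetherian_wf NX)) (osucc stature).
Proof.
split; last by move=> _; exists H0_top; exact: ole_refl.
move=> C; exists tt; have [->|CT] := eqVneq C H0_top; first exact: ole_refl.
apply/oltW/rk_lt; rewrite lt_neqAle CT /=; exact/H0_leE.
Qed.

End hyperspace.

(* Main.v *)
Require Import Defs.
From HB Require Import structures.
From mathcomp Require Import all_boot all_order finmap.
From mathcomp Require Import all_classical topology.

Set Implicit Arguments.
Unset Strict Implicit.
Unset Printing Implicit Defensive.

Import Order.TTheory.

Local Open Scope classical_set_scope.

(** Take for X_alpha the tree alpha itself, its closed sets being the finite
    unions of subtrees. By recursion: the space of a tree whose immediate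
    subtrees are the [f i] is the disjoint union of the spaces of the [f i]
    plus a point, the root, where a closed set is either everything, or avoids
    the root, meets finitely many branches, and meets each of them in a closed
    set. Every claim is proved by induction on the tree, as a statement about
    this construction [topped].

    - Noetherian: a non-empty open set already contains the root and all but
      finitely many branches, and these finitely many are dealt with by
      induction ([topped_noetherian]).
    - Sober: an irreducible closed set that avoids the root cannot be spread
      over two branches; one that contains the root is the closure of the root
      ([topped_sober]).
    - Stature at least alpha: the branches are proper closed subsets, and the
      closed sets of the i-th branch embed in those of the whole space, so the
      whole space has rank greater than [f i] for every i
      ([ole_rk_tree_space]).
    - Countable chains: along a chain of closed sets, the finite sets of
      branches that are met form a chain as well, so such a set is determined
      by its cardinality; once it is known, the closed set is determined by
      finitely many slices, each in a chain of closed sets of a branch, which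
      is countable by induction. Hence finite sequences of natural numbers
      code the members of the chain ([topped_countable_closed_chains]).

    So each chain of closed sets has a countable ordinal as its length, and
    the chain length is at most aleph1, however large the stature is. *)

(** * Adjoining a root to a disjoint union of spaces *)

(** Stated for sets of sets, rather than for chains of [H0 X], so that
    slices of closed sets can be handled by preimages. *)
Definition countable_closed_chains (X : topologicalType) : Prop :=
  forall C : set (set X), C `<=` closed -> total_on C subset -> countable C.

(** The index is a [choiceType] so that finite sets of branches can be
    enumerated; an arbitrary index type is used through [{classic _}]. The
    root is [None]. *)
Definition topped (I : choiceType) (X : I -> topologicalType) : Type :=
  option {i : I & X i}.

Section topped.
Variables (I : choiceType) (X : I -> topologicalType).

HB.instance Definition _ := gen_eqMixin (topped X).
HB.instance Definition _ := gen_choiceMixin (topped X).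

Definition branch i (x : X i) : topped X := Some (existT _ i x).

Local Notation slice i F := (@branch i @^-1` F).

Lemma branch_inj i : injective (@branch i).
Proof.
by move=> x y xy; have := Some_inj xy; exact: existT_inj2.
Qed.

Lemma branch_index_inj i k (x : X i) (y : X k) : branch x = branch y -> i = k.
Proof. by move=> xy; have := existT_inj1 (Some_inj xy). Qed.

(** The empty set is open; the conditions constrain the others. They are the
    complements of: avoiding the root, meeting finitely many branches, having
    closed slices. *)
Definition topped_open (U : set (topped X)) : Prop :=
  U !=set0 -> [/\ U None,
    finite_set [set i | slice i U <> setT] &
    forall i, open (slice i U)].

Lemma topped_openT : topped_open setT.
Proof.
move=> _; split=> // [|i]; last by rewrite preimage_setT; exact: openT.
by apply: sub_finite_set (finite_set0 I) => i; rewrite /= preimage_setT.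
Qed.

Lemma topped_openI : setI_closed topped_open.
Proof.
move=> U V oU oV [x [Ux Vx]].
have [UN Ufin Uo] := oU (ex_intro _ x Ux).
have [VN Vfin Vo] := oV (ex_intro _ x Vx).
split=> // [|i]; last exact: openI.
have UVfin := conj Ufin Vfin; rewrite -finite_setU in UVfin.
apply: sub_finite_set UVfin => i /= nUV.
apply: contrapT => /not_orP[/contrapT Ui /contrapT Vi]; apply: nUV.
by rewrite preimage_setI Ui Vi setIT.
Qed.

Lemma topped_open_bigcup (J : Type) (f : J -> set (topped X)) :
  (forall j, topped_open (f j)) -> topped_open (\bigcup_j f j).
Proof.
move=> fo [x [j _ fjx]]; have [fjN fjfin _] := fo j (ex_intro _ x fjx).
split=> [||i]; first by exists j.
  apply: sub_finite_set fjfin => i /= nf fji; apply: nf.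
  by rewrite -subTset -fji => y fjy; exists j.
rewrite preimage_bigcup; apply: bigcup_open => k _.
have [[y fky]|/nonemptyPn fk0] := pselect (f k !=set0).
  by have [_ _] := fo k (ex_intro _ y fky); exact.
by rewrite fk0 preimage_set0; exact: open0.
Qed.

HB.instance Definition _ := isOpenTopological.Build (topped X)
  topped_openT topped_openI topped_open_bigcup.

Lemma open_toppedE (U : set (topped X)) : open U = topped_open U.
Proof. by []. Qed.

Lemma branch_preimage_image i (G : set (X i)) :
  slice i (@branch i @` G) = G.
Proof.
apply/seteqP; split=> [x [y Gy /branch_inj <-]//|x Gx]; by exists x.
Qed.

Lemma branch_preimage_image_neq i k (G : set (X i)) : k <> i ->
  slice k (@branch i @` G) = set0.
Proof.
by move=> ki; apply/seteqP; split=> // x [y _ /branch_index_inj ik]; case: ki.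
Qed.

Lemma open_branch i (U : set (topped X)) : open U -> open (slice i U).
Proof.
rewrite open_toppedE => oU.
have [[x Ux]|/nonemptyPn U0] := pselect (U !=set0).
  by have [_ _] := oU (ex_intro _ x Ux); exact.
by rewrite U0 preimage_set0; exact: open0.
Qed.

Lemma closed_branch i (F : set (topped X)) :
  closed F -> closed (slice i F).
Proof. by rewrite -!openC preimage_setC; exact: open_branch. Qed.

Lemma closed_top (F : set (topped X)) : closed F -> F None -> F = setT.
Proof.
rewrite -openC open_toppedE => oF FN; rewrite -subTset => x _.
apply: contrapT => nFx; have [/=] := oF (ex_intro _ x nFx); exact.
Qed.

Lemma closed_finite_branches (F : set (topped X)) : closed F -> ~ F None ->
  finite_set [set i | slice i F !=set0].
Proof.
rewrite -openC open_toppedE => oF nFN.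
have [_ Ffin _] := oF (ex_intro _ None nFN).
apply: sub_finite_set Ffin => i [y Fy] /= CF.
by have : (slice i (~` F)) y by rewrite CF.
Qed.

Lemma closed_topped (F : set (topped X)) : ~ F None ->
  finite_set [set i | slice i F !=set0] ->
  (forall i, closed (slice i F)) -> closed F.
Proof.
move=> nFN Ffin Fc; rewrite -openC open_toppedE => _; split=> // [|i].
  apply: sub_finite_set Ffin => i /= FT; apply: contrapT => /nonemptyPn F0.
  by apply: FT; rewrite -preimage_setC F0 setC0.
by rewrite -preimage_setC openC.
Qed.

Lemma closed_branch_image i (G : set (X i)) :
  closed G -> closed (@branch i @` G).
Proof.
move=> cG; apply: closed_topped => [[]//||k].
  apply: sub_finite_set (finite_set1 i) => k [x [y _]] /=.
  by move=> /branch_index_inj->.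
have [->|/eqP ki] := eqVneq k i; first by rewrite branch_preimage_image.
by rewrite branch_preimage_image_neq//; exact: closed0.
Qed.

(** Any one non-empty member of a cover covers the root and all but finitely
    many branches; each remaining branch needs finitely many more members. *)
Lemma topped_noetherian :
  (forall i, noetherian (X i)) -> noetherian (topped X).
Proof.
move=> NX U oU J D f fo Uf.
have [[j Dj [x fjx]]|none] := pselect (exists2 j, D j & f j !=set0); last first.
  exists fset0 => [?|x /Uf[j Dj fjx]]; first by rewrite in_fset0.
  by case: none; exists j => //; exists x.
have [fjN fjfin _] := fo j Dj (ex_intro _ x fjx).
have /choice[E EP] i : exists E : {fset J}, {subset E <= D} /\
    slice i U `<=` cover [set` E] (fun k => slice i (f k)).
  have [|k Dk|y /Uf//|E ED UE] := NX i (slice i U) _ J D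
    (fun k => slice i (f k)); last by exists E.
  - exact: open_branch.
  - by apply: open_branch; exact: fo.
pose K := fset_set [set i | slice i (f j) <> setT].
exists (j |` \bigcup_(i <- K) E i)%fset => [k|[[i y]|] Uy].
- rewrite !inE => /predU1P[->//|/bigfcupP[i _ kE]]; apply/set_mem.
  by have [/(_ _ kE)] := EP i.
- have [fjT|fjT] := pselect (slice i (f j) = setT).
    exists j; first by rewrite /= !inE eqxx.
    by have : (slice i (f j)) y by rewrite fjT.
  have [_ /(_ y Uy)[k kE fky]] := EP i; exists k => //=.
  rewrite !inE; apply/orP; right; apply/bigfcupP; exists i => //.
  by rewrite andbT in_fset_set// inE.
- by exists j => //=; rewrite !inE eqxx.
Qed.

Lemma closure_top : closure [set None : topped X] = setT.
Proof. by apply: closed_top; [exact: closed_closure|exact: subset_closure]. Qed.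

Lemma closure_branch i (x : X i) :
  closure [set branch x] = @branch i @` closure [set x].
Proof.
rewrite (closureE [set branch x]); apply/seteqP; split.
  apply: smallest_sub => [|_ ->].
    exact/closed_branch_image/closed_closure.
  by exists x => //; exact: subset_closure.
move=> _ [y xy <-] F [cF xF]; move: y xy; rewrite closureE; apply: smallest_sub.
  exact: closed_branch.
by move=> _ ->; exact: xF.
Qed.

(** A branch and its complement in an irreducible closed set [C] avoiding the
    root are both closed, so [C] lies in a single branch and its generic point
    is found there. *)
Lemma topped_sober : (forall i, sober (X i)) -> sober (topped X).
Proof.
move=> SX C [cC [x Cx] irr].
have [CN|nCN] := pselect (C None).
  rewrite (closed_top cC CN).
  exists None; split=> [|[[i y]|//] yT]; first by rewrite closure_top.
  have : closure [set branch y] None by rewrite -yT.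
  by rewrite closure_branch => -[].
case: x Cx => [[i x]|//] Cx; pose G := slice i C.
(* [C] meets the [i]-th branch in [x], so it is not inside its complement. *)
have CE : C = @branch i @` G.
  have [||||CR] := irr (range (@branch i)) (C `\` range (@branch i)).
  - exact/closed_branch_image/closedT.
  - apply: closed_topped => [[]//||k].
      apply: sub_finite_set (closed_finite_branches cC nCN) => k [y []].
      by exists y.
    rewrite setDE preimage_setI -preimage_setC -setDE.
    have [->|/eqP ki] := eqVneq k i.
      by rewrite branch_preimage_image setDT; exact: closed0.
    by rewrite branch_preimage_image_neq// setD0; exact: closed_branch.
  - by move=> y Cy; have [Ry|Ry] := pselect (range (@branch i) y); [left|right].
  - move=> CR; apply/seteqP; split=> [y Cy|_ [y Gy <-]//].
    by have [z _ zy] := CR y Cy; exists z => //; rewrite /G /= zy.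
  - by have [_] := CR _ Cx; case; exists x.
have irrG : irreducible_closed G.
  split=> [||F1 F2 cF1 cF2 GF]; [exact: closed_branch|by exists x|].
  have [|||CF|CF] := irr (@branch i @` F1) (@branch i @` F2);
    try exact: closed_branch_image.
  - by rewrite CE -image_setU; exact: image_subset.
  - by left; rewrite -(branch_preimage_image F1) /G; exact: preimage_subset.
  - by right; rewrite -(branch_preimage_image F2) /G; exact: preimage_subset.
have [y [Gy yuniq]] := SX i G irrG.
exists (branch y); split=> [|z Cz]; first by rewrite closure_branch -Gy.
have : C z by rewrite Cz; exact: subset_closure.
rewrite CE => -[z' _ zz']; rewrite -zz'; congr branch; apply: yuniq.
by rewrite /G Cz -zz' closure_branch branch_preimage_image.
Qed.

(** A member of the chain is coded by the sequence of the codes of its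
    non-empty slices. Of two members with codes of the same length, the smaller
    one meets as many branches as the larger one, hence the same ones, and the
    slices are then compared one by one; so coding is injective. *)
Lemma topped_countable_closed_chains :
  (forall i, countable_closed_chains (X i)) ->
  countable_closed_chains (topped X).
Proof.
move=> XC C Cc Ctot.
have code i : exists c : set (X i) -> nat,
    {in [set slice i F | F in C] &, injective c}.
  apply/countable_injP; apply: XC => [_ [F CF <-]|_ _ [F CF <-] [G CG <-]].
    by apply: closed_branch; exact: Cc.
  by case: (Ctot _ _ CF CG) => FG; [left|right]; exact: preimage_subset.
pose c i := sval (cid (code i)).
have c_inj i F G : C F -> C G ->
    c i (slice i F) = c i (slice i G) -> slice i F = slice i G.
  move=> CF CG; apply: (svalP (cid (code i))); apply/mem_set.
    by exists F.
  by exists G.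
pose S (F : set (topped X)) : {fset I} :=
  fset_set [set i | slice i F !=set0].
have SP F i : C F -> ~ F None ->
    reflect (slice i F !=set0) (i \in S F).
  move=> CF nFN; rewrite in_fset_set.
    by apply: (iffP idP) => [/set_mem|/mem_set].
  exact: closed_finite_branches (Cc _ CF) _.
(* [None] codes the whole space, the only closed set that contains the root. *)
pose w (F : set (topped X)) : option (seq nat) :=
  if `[< F None >] then None
  else Some [seq c i (slice i F) | i <- S F].
suff w_inj F G : C F -> C G -> F `<=` G -> w F = w G -> F = G.
  apply/countable_injP; exists (choice.pickle \o w) => F G.
  move=> /set_mem CF /set_mem CG /(pcan_inj choice.pickleK) wFG.
  by have [FG|GF] := Ctot _ _ CF CG; [|apply/esym]; exact: w_inj.
move=> CF CG FG; rewrite /w.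
case: asboolP => FN; case: asboolP => GN // wFG.
  by rewrite (closed_top (Cc _ CF) FN) (closed_top (Cc _ CG) GN).
case: wFG => wFG; have SFG : S F = S G.
  apply/eqP; rewrite eqEfcard; apply/andP; split; last first.
    by have /(congr1 size) := wFG; rewrite !size_map => ->.
  apply/fsubsetP => i /(SP _ _ CF FN)[x Fx]; apply/(SP _ _ CG GN).
  by exists x; exact: FG.
apply/seteqP; split=> // -[[i x]|//] Gx.
have iF : i \in S F by rewrite SFG; apply/(SP _ _ CG GN); exists x.
rewrite -SFG in wFG; have /eq_in_map/(_ i iF)/(c_inj _ _ _ CF CG) E := wFG.
by have : (slice i F) x by rewrite E.
Qed.

End topped.

(** * The space of a tree *)

Fixpoint tree_space (a : Ord) : topologicalType :=
  let: osupS J f := a in @topped {classic J} (fun i => tree_space (f i)).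

(** The strictly increasing map [g] into a well-founded relation, instead of
    the identity of the closed sets, makes the induction go through: for the
    [i]-th subtree, [g] is precomposed with the embedding of its closed sets. *)
Lemma ole_rk_tree_space (T : Type) (R : T -> T -> Prop) (wfR : well_founded R)
    (a : Ord) (g : set (tree_space a) -> T) :
  (forall F G, closed F -> closed G -> F `<` G -> R (g F) (g G)) ->
  ole a (rk wfR (g setT)).
Proof.
elim: a g => J f IH g g_mono; apply/oleE => i.
pose b := @branch {classic J} (fun i => tree_space (f i)) i.
have bT : R (g (range b)) (g setT).
  apply: g_mono; [exact/closed_branch_image/closedT|exact: closedT|].
  by rewrite properEneq; split=> //; apply/eqP => /seteqP[_ /(_ None I)[]].
apply: ole_lt_trans (rk_lt wfR bT).
apply: (IH i (fun G => g (b @` G))) => F G cF cG [FG GF].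
apply: g_mono; try exact: closed_branch_image.
split; first exact: image_subset.
move=> bGF; apply: GF => x Gx.
by have [|y Fy /branch_inj <-] := bGF (b x); first by exists x.
Qed.

Lemma tree_space_noetherian a : noetherian (tree_space a).
Proof. by elim: a => J f IH; exact: topped_noetherian. Qed.

Lemma tree_space_sober a : sober (tree_space a).
Proof. by elim: a => J f IH; exact: topped_sober. Qed.

Lemma tree_space_countable_closed_chains a :
  countable_closed_chains (tree_space a).
Proof. by elim: a => J f IH; exact: topped_countable_closed_chains. Qed.

(** * Countable chains have length at most aleph1 *)

(** Otherwise every ordinal below aleph1 would be the height of an element of
    [C], and an enumeration of [C] would enumerate them all. *)
Lemma countable_order_type_le_aleph1 d (P : porderType d) (C : set P) (a : Ord) :
  countable C -> order_type C a -> ole a aleph1.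
Proof.
move=> /countable_injP[c c_inj] [f [_ aC _]].
have [//|a1] := ole_total a aleph1.
case: aleph1_first_uncountable => -[].
have /choice[g gP] n : exists b, forall x, C x -> c x = n -> b = f x.
  have [[x Cx cx]|none] := pselect (exists2 x, C x & c x = n).
    exists (f x) => y Cy cy; congr f; apply: c_inj; rewrite ?inE ?cx//.
  by exists aleph1 => x Cx cx; case: none; exists x.
exists g => b b1; have [x Cx bx] := aC b (olt_trans b1 a1).
by exists (c x); rewrite (gP _ x).
Qed.

(** * Stature and chains of the space of a tree *)

Lemma ole_stature_tree_space a (NX : noetherian (tree_space a)) :
  ole a (stature NX).
Proof.
pose H := insubd (H0_top (tree_space a)).
have HE F : closed F -> val (H F) = F.
  by move=> cF; rewrite insubdK//; exact/asboolP.
have -> : stature NX = rk (noetherian_wf NX) (H setT).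
  by congr rk; apply: val_inj; rewrite HE//; exact: closedT.
apply: (@ole_rk_tree_space _ _ _ a H) => F G cF cG [FG GF].
rewrite lt_leAnge; apply/andP; split; first by apply/H0_leE; rewrite !HE.
by apply/negP => /H0_leE; rewrite !HE.
Qed.

Lemma countable_chain_H0 (X : topologicalType) (C : set (H0 X)) :
  countable_closed_chains X -> chain C -> countable C.
Proof.
move=> XC [_ Ctot].
have /countable_injP[c c_inj] : countable [set val F | F in C].
  apply: XC => [_ [F _ <-]|_ _ [F CF <-] [G CG <-]].
    exact: asboolW (valP F).
  by have [/H0_leE|/H0_leE] := Ctot F G CF CG; [left|right].
apply/countable_injP; exists (c \o val) => F G /set_mem CF /set_mem CG.
move=> /c_inj FG; apply: val_inj; apply: FG; apply/mem_set; first by exists F.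
by exists G.
Qed.

Lemma chain_length_le_aleph1 d (P : porderType d) (wfP : wf_poset P) :
  (forall C : set P, chain C -> countable C) -> ole (chain_length wfP) aleph1.
Proof.
move=> cP; apply: osup_le => -[C chC]; rewrite /length_of_chain.
by case: cid => a /=; apply: countable_order_type_le_aleph1; exact: cP.
Qed.

Theorem proposition3p4 (alpha : Ord) :
  exists (X : topologicalType) (NX : noetherian X),
    [/\ [set: X] !=set0,
        sober X,
        ole alpha (stature NX),
        forall C : set (H0 X), chain C -> countable C
      & ole aleph1 alpha ->
          olt (chain_length (noetherian_wf NX)) (osucc (stature NX))].
Proof.
have cC (C : set (H0 (tree_space alpha))) : chain C -> countable C.
  exact/countable_chain_H0/tree_space_countable_closed_chains.
exists (tree_space alpha), (@tree_space_noetherian alpha).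
split=> // [|||a1].
- by case: alpha {cC} => J f; exists None.
- exact: tree_space_sober.
- exact: ole_stature_tree_space.
- exists tt; apply: ole_trans (ole_stature_tree_space _); apply: ole_trans a1.
  exact: chain_length_le_aleph1.
Qed.
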